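(* Let $\mathfrak{g}$ be a finite-dimensional real filiform Lie algebra which is not characteristically nilpotent (that is, $\mathfrak{g}$ admits at least one derivation that is not nilpotent). Then $\mathfrak{g}$ admits an affine structure.
   Context: All Lie algebras are finite-dimensional and real. An affine structure on a Lie algebra $\mathfrak{g}$ is a bilinear map $\nabla:\mathfrak{g}\times\mathfrak{g}\to\mathfrak{g}$, written $(X,Y)\mapsto X\cdot Y=\nabla_X Y$, such that for all $X,Y,Z\in\mathfrak{g}$: (1) $X\cdot(Y\cdot Z)-Y\cdot(X\cdot Z)=(X\cdot Y)\cdot Z-(Y\cdot X)\cdot Z$; (2) $X\cdot Y-Y\cdot X=[X,Y]$. (Equivalently, the torsion $\nabla_XY-\nabla_YX-[X,Y]$ and the curvature $\nabla_X\nabla_Y-\nabla_Y\nabla_X-\nabla_{[X,Y]}$ vanish.) The descending central sequence of $\mathfrak{g}$ is $\mathcal{C}^1\mathfrak{g}=[\mathfrak{g},\mathfrak{g}]$, $\mathcal{C}^{i+1}\mathfrak{g}=[\mathfrak{g},\mathcal{C}^i\mathfrak{g}]$. An $n$-dimensional nilpotent Lie algebra $\mathfrak{g}$ is called filiform if $\dim\mathcal{C}^i\mathfrak{g}=n-i-1$ for $i=1,\dots,n-1$ (so $\dim \mathcal{C}^1\mathfrak{g}=n-2$ and $\mathcal{C}^{n-1}\mathfrak{g}=\{0\}$). A Lie algebra is called characteristically nilpotent if every derivation of it is a nilpotent endomorphism. *)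

(* Defs.v *)
From mathcomp Require Import all_boot all_order all_algebra.
From mathcomp Require Import reals.

Set Implicit Arguments.
Unset Strict Implicit.
Unset Printing Implicit Defensive.

Import GRing.Theory.
Local Open Scope ring_scope.

Section LieAlgebras.
Variables (F : fieldType) (L : vectType F).
Implicit Types (br : {bilinear L -> L -> L}) (D : 'End(L)) (U W X : {vspace L}).

Record is_lie_bracket br : Prop := IsLieBracket {
  lie_alternating : forall x, br x x = 0;
  lie_jacobi : forall x y z,
    br x (br y z) + br y (br z x) + br z (br x y) = 0 }.

(* [U, W]: as for [prodv] in falgebra, spanned by the brackets of basis
   vectors; [lie_prodvP] shows that it is the span of all brackets. *)
Definition lie_prodv br U W : {vspace L} :=
  <<[seq br u w | u <- vbasis U, w <- vbasis W]>>%VS.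

Lemma memv_lie_prodv br U W u w :
  u \in U -> w \in W -> br u w \in lie_prodv br U W.
Proof.
move=> /coord_vbasis -> /coord_vbasis ->.
rewrite linear_sumlz; apply: memv_suml => i _.
rewrite linear_sumr; apply: memv_suml => j _.
rewrite linearZl_LR linearZr_LR /= !memvZ // memv_span //.
by apply: allpairs_f; rewrite mem_nth // size_tuple.
Qed.

Lemma lie_prodvP br U W X :
  reflect (forall u w, u \in U -> w \in W -> br u w \in X)
          (lie_prodv br U W <= X)%VS.
Proof.
apply: (iffP idP) => [sX u w Uu Ww | brX].
  exact: subvP sX _ (memv_lie_prodv br Uu Ww).
apply/span_subvP => _ /allpairsP[[u w] /= [Uu Ww ->]].
by apply: brX; apply: vbasis_mem.
Qed.

(* C^0 = L, so that C^1 = [L, L] and C^(i+1) = [L, C^i]. *)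
Definition central_series br (i : nat) : {vspace L} :=
  iter i (lie_prodv br fullv) fullv.

Definition lie_nilpotent br : Prop :=
  exists i, central_series br i = 0%VS.

(* The natural subtraction is exact, since 1 <= i < n. *)
Definition filiform br : Prop :=
  let n := \dim {: L} in
  lie_nilpotent br /\
  forall i : nat, (1 <= i <= n - 1)%N ->
    \dim (central_series br i) = (n - i - 1)%N.

Definition lie_derivation br D : Prop :=
  forall x y, D (br x y) = br (D x) y + br x (D y).

Definition nilpotent_endomorphism D : Prop :=
  exists k, forall x, iter k D x = 0.

Definition characteristically_nilpotent br : Prop :=
  forall D, lie_derivation br D -> nilpotent_endomorphism D.

Record is_affine_structure br (nabla : {bilinear L -> L -> L}) : Prop :=
  IsAffineStructure {
  affine_left_symmetric : forall x y z,
    nabla x (nabla y z) - nabla y (nabla x z) =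
    nabla (nabla x y) z - nabla (nabla y x) z;
  affine_torsion_free : forall x y, nabla x y - nabla y x = br x y }.

End LieAlgebras.

(* Main.v *)
(* Let [D] be a non-nilpotent derivation. If [D] is injective, then
   [D^-1 o ad x o D] is an affine structure. In dimension at most 3 the algebra
   is 2-step nilpotent and [1/2 [x, y]] is one. Otherwise let [V 2] be the
   hyperplane centralizing [C^1 / C^3]; with [V 1 = L] and [V i = C^(i-2)] it
   forms a complete flag stable under [D]. If [lam] and [mu] are the eigenvalues
   of [D] on the first two lines of the flag, the next ones are
   [mu + lam, mu + 2 lam, ...], with a possible exception at the last step. As
   [D] is singular but not nilpotent, [mu] is not a positive multiple of [lam],
   and comparing weights then forces [[V 2, V 2]] into the last line of the
   flag. Hence [V 2] is an ideal of codimension 1 that is at most 2-step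
   nilpotent, and its affine structure [1/2 [x, y]] extends to [L]. *)

From HB Require Import structures.
Require Import Defs.
From mathcomp Require Import all_boot all_order all_algebra.
From mathcomp Require Import reals.
From mathcomp Require Import ring zify.
From mathcomp Require boolp.

Set Implicit Arguments.
Unset Strict Implicit.
Unset Printing Implicit Defensive.

Import GRing.Theory Num.Theory.
Local Open Scope ring_scope.

Lemma eq_coord_vbasis (F : fieldType) (L : vectType F) (x y : L) :
  (forall i, coord (vbasis fullv) i x = coord (vbasis fullv) i y) -> x = y.
Proof.
move=> eq_xy; rewrite (coord_vbasis (memvf x)) (coord_vbasis (memvf y)).
by apply: eq_bigr => i _; rewrite eq_xy.
Qed.

(* Decides identities between linear combinations in a [vectType], by
   [ring] on coordinates. *)
Ltac vect_ring :=
  apply: eq_coord_vbasis => ?;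
  rewrite ?(linearD, linearN, linearZ, linear0) /=; ring.

(** * Bracket identities and two constructions of affine structures *)

Section Lie.
Variables (F : numFieldType) (L : vectType F) (br : {bilinear L -> L -> L}).
Hypothesis br_lie : is_lie_bracket br.
Implicit Types (x y z : L) (T : {vspace L}).

Lemma lie_antisym x y : br x y = - br y x.
Proof.
apply/eqP; rewrite -addr_eq0; apply/eqP.
have := lie_alternating br_lie (x + y).
rewrite linearDl /= !linearDr /= !(lie_alternating br_lie).
by rewrite add0r addr0.
Qed.

Lemma lie_leibniz x y z : br x (br y z) = br (br x y) z + br y (br x z).
Proof.
have := lie_jacobi br_lie x y z.
rewrite (lie_antisym z (br x y)) (lie_antisym z x) linearNr /=.
by move/eqP; rewrite subr_eq0 => /eqP <-; vect_ring.
Qed.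

(** Reduces a bracket to that of representatives [e] and [f] of one-dimensional quotients, up to
    bracket terms of higher degree. *)
Lemma mem_lie_mod (X : {vspace L}) c d e f x y :
    br e f \in X -> br e (y - d *: f) \in X -> br (x - c *: e) y \in X ->
  br x y \in X.
Proof.
move=> Xef Xey Xxy.
have -> : br x y = c * d *: br e f + c *: br e (y - d *: f) + br (x - c *: e) y.
  rewrite linearBl linearZl_LR /= linearB linearZ /= -scalerA; vect_ring.
by rewrite !rpredD ?rpredZ.
Qed.

Lemma mem_lie_modr (X : {vspace L}) d f x y :
  br x f \in X -> br x (y - d *: f) \in X -> br x y \in X.
Proof.
move=> Xf; rewrite linearB linearZ /= rpredBr //; exact: rpredZ.
Qed.

Lemma affine_structure_of_fun (nabla : L -> L -> L) :
    bilinear_for *:%R *:%R nabla ->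
    (forall x y z, nabla x (nabla y z) - nabla y (nabla x z) =
                   nabla (nabla x y) z - nabla (nabla y x) z) ->
    (forall x y, nabla x y - nabla y x = br x y) ->
  exists nabla' : {bilinear L -> L -> L}, is_affine_structure br nabla'.
Proof.
move=> nabla_bilin flat torsion_free.
pose nablaM := bilinear_isBilinear.Build F L L L *:%R *:%R nabla nabla_bilin.
pose nabla' : {bilinear L -> L -> L} := HB.pack nabla nablaM.
by exists nabla'.
Qed.

(* [nabla x] is the conjugate [D^-1 o ad x o D], hence flat; torsion-freeness
   is the derivation rule. *)
Lemma affine_of_injective_derivation (D : 'End(L)) :
    lie_derivation br D -> lker D == 0%VS ->
  exists nabla : {bilinear L -> L -> L}, is_affine_structure br nabla.
Proof.
move=> derD kerD; have injD : injective D by apply/lker0P.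
pose nabla x y := D^-1%VF (br x (D y)).
have DK x y : D (nabla x y) = br x (D y) by rewrite /nabla lker0_lfunVK.
have torsion_free x y : nabla x y - nabla y x = br x y.
  apply: injD.
  by rewrite linearB /= !DK derD (lie_antisym y) opprK addrC.
apply: (@affine_structure_of_fun nabla) => //.
  split=> [y a x x' | x a y y']; rewrite /nabla.
    by rewrite linearPl /= linearP.
  by rewrite linearP linearPr /= linearP.
move=> x y z; apply: injD.
by rewrite !linearB /= !DK lie_leibniz addrK -linearBl /= torsion_free.
Qed.

(* [T] carries the affine structure [1/2 [x, y]], which is invariant under
   [ad x0]; let [x0] act on it by [ad x0]. *)
Lemma affine_of_two_step_hyperplane (x0 : L) T :
    (forall x, x \in <[x0]> + T)%VS ->
    (forall x y, br x y \in T) ->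
    (forall x y z, x \in T -> y \in T -> z \in T -> br x (br y z) = 0) ->
  exists nabla : {bilinear L -> L -> L}, is_affine_structure br nabla.
Proof.
move=> spanL brT T2.
pose p := addv_pi2 <[x0]> T; pose q := addv_pi1 <[x0]> T.
have qp x : x = q x + p x by rewrite addv_pi1_pi2.
have pT x : p x \in T by apply: memv_pi2.
have p_id x : x \in T -> p x = x by apply: addv_pi2_id.
have q0 x : x \in T -> q x = 0.
  by move=> Tx; have /eqP := qp x; rewrite p_id // -subr_eq subrr => /eqP.
have brqq x y : br (q x) (q y) = 0.
  have /vlineP[a ->] : q x \in <[x0]>%VS by apply: memv_pi1.
  have /vlineP[b ->] : q y \in <[x0]>%VS by apply: memv_pi1.
  by rewrite linearZl_LR linearZr_LR /= (lie_alternating br_lie) !scaler0.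
pose nabla x y := br (q x) (p y) + 2^-1 *: br (p x) (p y).
have half (v : L) : 2^-1 *: v + 2^-1 *: v = v.
  by rewrite -scalerDl -[RHS]scale1r; congr (_ *: _); field.
have nablaT x y : nabla x y \in T by rewrite rpredD ?rpredZ.
have torsion_free x y : nabla x y - nabla y x = br x y.
  rewrite {3}(qp x) {3}(qp y) linearDl /= !linearDr /= brqq /nabla.
  rewrite (lie_antisym (p y) (p x)) (lie_antisym (p x) (q y)).
  by rewrite -{3}(half (br (p x) (p y))); vect_ring.
apply: (@affine_structure_of_fun nabla) => //.
- split=> [z a x x' | z a x x']; rewrite /nabla.
    by rewrite !linearP !linearPl /=; vect_ring.
  by rewrite !linearP /=; vect_ring.
move=> x y z.
have nabla_nabla u v : nabla u (nabla v z) = br (q u) (br (q v) (p z))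
     + 2^-1 *: br (q u) (br (p v) (p z)) + 2^-1 *: br (p u) (br (q v) (p z)).
  rewrite {1}/nabla p_id // /nabla !linearDr /= !linearZr_LR /=.
  by rewrite (T2 (p u) (p v)) // scaler0 addr0.
have nabla_T u : u \in T -> nabla u z = 2^-1 *: br u (p z).
  by move=> Tu; rewrite /nabla q0 // linear0l add0r p_id.
rewrite !nabla_nabla !nabla_T // -scalerBr -linearBl /= torsion_free.
have -> : br x y = br (q x) (p y) + br (p x) (q y) + br (p x) (p y).
  by rewrite {1}(qp x) {1}(qp y) linearDl /= !linearDr /= brqq; vect_ring.
rewrite !linearDl /=.
have -> : br (br (p x) (p y)) (p z) = 0.
  by rewrite lie_antisym T2 // oppr0.
(* As [br (q x) (q y) = 0], the actions of [q x] and [q y] commute. *)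
have := lie_leibniz (q x) (q y) (p z); rewrite brqq linear0l add0r => ->.
rewrite (lie_leibniz (q x) (p y)) (lie_leibniz (p x) (q y)).
vect_ring.
Qed.
End Lie.

Lemma line_modP (F : fieldType) (L : vectType F) (X Y : {vspace L}) e x :
    (Y <= X)%VS -> (\dim X <= (\dim Y).+1)%N -> e \in X -> e \notin Y ->
  x \in X -> exists c, x - c *: e \in Y.
Proof.
move=> sYX dimX Xe Ye Xx.
have sYeX : (<[e]> + Y <= X)%VS by rewrite subv_add sYX -memvE Xe.
have eqX : (<[e]> + Y)%VS = X.
  apply/eqP; rewrite eqEdim sYeX /=; apply: leq_trans dimX _.
  rewrite (ltn_leqif (dimv_leqif_sup (addvSr _ _))).
  by rewrite subv_add -memvE (negPf Ye).
move: Xx; rewrite -eqX => /memv_addP[_ /vlineP[c ->] [y Yy ->]].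
by exists c; rewrite addrC addKr.
Qed.

(** * Degrees of brackets along the flag *)

Section Flag.
Variables (F : numFieldType) (L : vectType F) (br : {bilinear L -> L -> L}).
Hypothesis br_lie : is_lie_bracket br.
Implicit Types (x y z u v : L) (a b i j k m : nat) (X : {vspace L}).

(* [V i] is [C^(i-2)] for [i >= 3], and [V 2] is the centralizer of
   [C^1 / C^3], so that the dimension drops by one at each step from
   [V 1 = L]. *)
Record filiform_flag (V : nat -> {vspace L}) : Prop := FiliformFlag {
  flag_full : V 1%N = fullv;
  flag_dim : forall i, (0 < i)%N -> \dim (V i) = (\dim {: L} + 1 - i)%N;
  flag_gen : forall i, (1 < i)%N -> V i.+1 = lie_prodv br fullv (V i);
  flag_derived : V 3%N = lie_prodv br fullv fullv;
  flag_centralizer : forall u,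
    u \in V 2%N <-> (forall v, v \in V 3%N -> br u v \in V 5%N) }.

Variable V : nat -> {vspace L}.
Hypothesis flagV : filiform_flag V.
Let n := \dim {: L}.

Lemma mem_flag1 x : x \in V 1.
Proof. by rewrite (flag_full flagV) memvf. Qed.

Lemma flag_br3 u v : br u v \in V 3.
Proof. by rewrite (flag_derived flagV) memv_lie_prodv ?memvf. Qed.

Lemma flag_br_gt1 i u v : (1 < i)%N -> v \in V i -> br u v \in V i.+1.
Proof. by move=> i_gt1 Vv; rewrite (flag_gen flagV) // memv_lie_prodv ?memvf. Qed.

Lemma flag_ind i (f : 'End(L)) X : (1 < i)%N ->
    (forall u v, v \in V i -> f (br u v) \in X) ->
  forall w, w \in V i.+1 -> f w \in X.
Proof.
move=> i_gt1 fX w; rewrite memv_preim; apply/subvP.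
rewrite (flag_gen flagV) //; apply/lie_prodvP => u v _ Vv.
by rewrite -memv_preim fX.
Qed.

Lemma flag_ind_br i y X : (1 < i)%N ->
    (forall u v, v \in V i -> br (br u v) y \in X) ->
  forall w, w \in V i.+1 -> br w y \in X.
Proof.
move=> i_gt1 brX w Vw; rewrite -applyrE -lfunE; apply: flag_ind Vw => // u v Vv.
by rewrite lfunE /= brX.
Qed.

Lemma flag_subS i : (0 < i)%N -> (V i.+1 <= V i)%VS.
Proof.
case: i => // i _; elim: i => [|i IHi]; first by rewrite (flag_full flagV) subvf.
case: i => [|i] in IHi *; last first.
  rewrite [X in (X <= _)%VS](flag_gen flagV) //.
  by apply/lie_prodvP => u v _ /(subvP IHi) Vv; rewrite flag_br_gt1.
(* The case [V 3 <= V 2]: by Jacobi, a bracket acts on [V 3] as the commutator of two maps raising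
   the degree by one. *)
apply/subvP => u Vu; apply/(flag_centralizer flagV) => v Vv.
apply: flag_ind_br Vu => // {}u y _; rewrite -[br _ _](addrK (br y (br u v))).
rewrite -(lie_leibniz br_lie) rpredB // !flag_br_gt1 //.
Qed.

Lemma flag_sub i j : (0 < i <= j)%N -> (V j <= V i)%VS.
Proof.
case/andP=> i_gt0; elim: j => [|j IHj]; first by rewrite leqn0 => /eqP <-.
rewrite leq_eqVlt => /predU1P[<- // | le_ij].
by apply: subv_trans (IHj le_ij); rewrite flag_subS //; lia.
Qed.

Lemma mem_flag i j u : u \in V j -> (0 < i <= j)%N -> u \in V i.
Proof. by move=> + le_ij; apply: subvP (flag_sub le_ij) u. Qed.

Lemma flag_br i u v : v \in V i -> (0 < i)%N -> br u v \in V i.+1.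
Proof.
move=> Vv i_gt0; have [i_gt1 | i_le1] := ltnP 1 i; first exact: flag_br_gt1.
by apply: (mem_flag (flag_br3 u v)); lia.
Qed.

Lemma flag_brl i u v : u \in V i -> (0 < i)%N -> br u v \in V i.+1.
Proof. by move=> Vu i_gt0; rewrite (lie_antisym br_lie) rpredN flag_br. Qed.

Lemma flag_eq0 i u : (n < i)%N -> u \in V i -> u = 0.
Proof.
move=> lt_ni; suff -> : V i = 0%VS by rewrite memv0 => /eqP.
by apply/eqP; rewrite -dimv_eq0 (flag_dim flagV) -/n; lia.
Qed.

Lemma flag_line i e u : e \in V i -> e \notin V i.+1 -> u \in V i ->
  (0 < i)%N -> exists c, u - c *: e \in V i.+1.
Proof.
move=> Ve nVe Vu i_gt0; apply: line_modP Ve nVe Vu; first exact: flag_subS.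
by rewrite !(flag_dim flagV) //; lia.
Qed.

Lemma flag_proper i : (0 < i <= n)%N -> ~~ (V i <= V i.+1)%VS.
Proof. by move=> le_in; apply/negP => /dimvS; rewrite !(flag_dim flagV) -/n; lia. Qed.

Lemma flag_rep i : (0 < i <= n)%N -> exists2 e, e \in V i & e \notin V i.+1.
Proof. by move/flag_proper/subvPn. Qed.

(** Jacobi induction on [a]. The first factor counts for one degree less than its index in the flag;
    [flag_graded_min] recovers this degree, up to the last line. *)
Lemma flag_graded a b u v : u \in V a.+1 -> v \in V b ->
  (0 < a)%N -> (0 < b)%N -> br u v \in V (a + b).
Proof.
elim: a b u v => // -[|a] IHa b u v Vu Vv _ b_gt0.
  by rewrite add1n flag_br.
apply: flag_ind_br Vu => // x w Vw.
rewrite -[br _ _](addrK (br w (br x v))) -(lie_leibniz br_lie).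
apply: rpredB; first by rewrite addSn flag_br ?IHa.
by rewrite addSnnS IHa ?flag_br.
Qed.

Lemma flag_graded_upto k a b u v :
    (forall j x w, (1 < j < k)%N -> x \in V 2 -> w \in V j -> br x w \in V j.+2) ->
    (1 < a)%N -> (1 < b)%N -> u \in V a -> v \in V b ->
  br u v \in V (minn (a + b) k.+1).
Proof.
move=> V2; case: a => // -[|a] // _; elim: a b u v => [|a IHa] b u v b_gt1 Vu Vv.
  have [lt_bk | le_kb] := ltnP b k.
    by apply: (mem_flag (V2 b _ _ _ Vu Vv)); lia.
  by apply: (mem_flag (flag_br u Vv _)); lia.
apply: flag_ind_br Vu => // x w Vw.
rewrite -[br _ _](addrK (br w (br x v))) -(lie_leibniz br_lie) rpredB //.
  by apply: (mem_flag (flag_br x (IHa _ _ _ b_gt1 Vw Vv) _)); lia.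
by apply: (mem_flag (IHa b.+1 _ _ _ Vw (flag_br x Vv _))); lia.
Qed.

Lemma flag_br23 u v : u \in V 2 -> v \in V 3 -> br u v \in V 5.
Proof. by move/(flag_centralizer flagV); apply. Qed.

Lemma flag_br22 u v : (3 < n)%N -> u \in V 2 -> v \in V 2 -> br u v \in V 5.
Proof.
move=> n_gt3 Vu Vv; have /flag_rep[e Ve nVe] : (0 < 2 <= n)%N by lia.
have [c Vuce] := flag_line Ve nVe Vu isT; have [d Vvde] := flag_line Ve nVe Vv isT.
apply: (mem_lie_mod (e := e) (f := e) (c := c) (d := d)).
- by rewrite (lie_alternating br_lie) mem0v.
- exact: flag_br23 Ve Vvde.
- by rewrite (lie_antisym br_lie) rpredN flag_br23.
Qed.

(* Suppose that [V 2] raises the degree of [V k], [k = m.+2], by one only. Take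
   [y] in [V 2] and [x] outside [V 2] with [br x] raising it by two, and let
   [Z i = (ad x)^i y], which spans [V i.+2] modulo [V i.+3] as long as [i <= m].
   Modulo the next term, [[Z i, Z j] = (-1)^i u] with [u = [y, Z m]] when
   [i + j = m], hence [[Z i, Z j] = - (-1)^i i [x, u]] when [i + j = m + 1]. At
   [j = 0] the left-hand side vanishes, so [[x, u] = 0]; as [[y, u] = 0] too,
   the flag would stop dropping at [V m.+4]. *)
Lemma flag_br2_step m : (1 < m)%N -> (m.+4 <= n)%N ->
    (forall j x w, (1 < j < m.+2)%N -> x \in V 2 -> w \in V j -> br x w \in V j.+2) ->
  forall x w, x \in V 2 -> w \in V m.+2 -> br x w \in V m.+4.
Proof.
move=> m_gt1 lt_mn V2.
have /flag_rep[x0 _ nVx0] : (0 < 1 <= n)%N by lia.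
have /flag_rep[y Vy nVy] : (0 < 2 <= n)%N by lia.
have /flag_rep[e Ve nVe] : (0 < m.+2 <= n)%N by lia.
suff Vye : br y e \in V m.+4.
  move=> x w Vx Vw.
  have [c Vx'] := flag_line Vy nVy Vx isT; have [d Vw'] := flag_line Ve nVe Vw isT.
  apply: mem_lie_mod Vye (flag_br _ Vw' isT) _ => //.
  by apply: (flag_graded (a := 2) Vx' Vw isT isT).
apply: contraT => nVye.
(* As [br y e] spans [V m.+3] modulo [V m.+4], correcting [x0] by a multiple of [y] sends [e] into
   [V m.+4]. *)
have [c Vx0e] := flag_line (flag_br y Ve isT) nVye (flag_br x0 Ve isT) isT.
pose x := x0 - c *: y.
have nVx : x \notin V 2.
  by apply: contra nVx0 => Vx; rewrite -(subrK (c *: y) x0) rpredD ?rpredZ.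
have Vxe : br x e \in V m.+4 by rewrite linearBl linearZl_LR.
have line_x u : exists t, u - t *: x \in V 2.
  by apply: (flag_line (mem_flag1 x) nVx (mem_flag1 u) isT).
have Vx w : w \in V m.+2 -> br x w \in V m.+4.
  move=> Vw; have [d Vw'] := flag_line Ve nVe Vw isT.
  exact: mem_lie_modr Vxe (flag_br _ Vw' isT).
pose Z i := iter i (br x) y.
have VZ i : Z i \in V i.+2 by elim: i => //= i IHi; rewrite flag_br.
have ZS i w : br (Z i.+1) w = br x (br (Z i) w) - br (Z i) (br x w).
  by rewrite (lie_leibniz br_lie) addrK.
(* Otherwise both [x] and [V 2] would send [V i.+2] into [V i.+4], although [[L, V i.+2] = V
   i.+3]. *)
have nVZ i : (i <= m)%N -> Z i \notin V i.+3.
  elim: i => // i IHi lt_im.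
  have {}IHi := IHi (ltnW lt_im).
  have /flag_proper : (0 < i.+3 <= n)%N by clear -lt_im lt_mn; lia.
  apply: contra => VZi; rewrite [X in (X <= _)%VS](flag_gen flagV) //.
  apply/lie_prodvP => u v _ Vv.
  have [t Vu'] := line_x u; have [d Vv'] := flag_line (VZ i) IHi Vv isT.
  apply: mem_lie_mod VZi (flag_br _ Vv' isT) _ => //.
  by apply: V2 Vu' Vv.
pose u := br y (Z m).
have Vu : u \in V m.+3 by rewrite flag_br.
have nVu : u \notin V m.+4.
  apply: contra nVye => Vu4; have [d Ve'] := flag_line (VZ m) (nVZ m (leqnn _)) Ve isT.
  exact: mem_lie_modr Vu4 (flag_br _ Ve' isT).
have ZZ_u i j : (i + j)%N = m -> br (Z i) (Z j) - (-1) ^+ i *: u \in V m.+4.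
  elim: i j => [|i IHi] j ij_m; first by rewrite /u -ij_m add0n expr0 scale1r subrr mem0v.
  rewrite ZS (_ : _ - _ = br x (br (Z i) (Z j)) - (br (Z i) (Z j.+1) - (-1) ^+ i *: u));
    last by rewrite exprS; vect_ring.
  rewrite rpredB ?IHi ?addnS // flag_br //.
  have := flag_graded_upto (a := i.+2) (b := j.+2) V2 isT isT (VZ i) (VZ j).
  by rewrite (_ : minn _ _ = m.+3) //; clear -ij_m; lia.
have ZZ_xu i j : (i + j)%N = m.+1 ->
    br (Z i) (Z j) + (-1) ^+ i * i%:R *: br x u \in V m.+4.+1.
  elim: i j => [|i IHi] j ij_m.
    by rewrite mulr0 scale0r addr0 (_ : j = m.+1) // flag_br // Vx.
  have ij : (i + j)%N = m by apply: succn_inj.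
  rewrite ZS (_ : _ + _ = br x (br (Z i) (Z j) - (-1) ^+ i *: u)
       - (br (Z i) (Z j.+1) + (-1) ^+ i * i%:R *: br x u)).
    by rewrite rpredB ?IHi ?addnS ?ij // flag_br // ZZ_u.
  by rewrite linearB linearZ /= exprS -natr1; vect_ring.
(* Taking [j = 0] leaves the coefficient [m.+1] up to sign, nonzero in characteristic 0. *)
have Vxu : br x u \in V m.+4.+1.
  have Vm1 : br (Z m.+1) (Z 0) \in V m.+4.+1 by rewrite flag_brl // Vx.
  have := ZZ_xu m.+1 0%N (addn0 _).
  by rewrite rpredDl // rpredZeq mulf_eq0 signr_eq0 pnatr_eq0.
(* Replace [u] by [- br (Z 1) (Z m.-1)] and apply Leibniz: [y] raises the degree of both factors by
   two. *)
have Vyu : br y u \in V m.+4.+1.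
  have Vym : br y (Z m.-1) \in V m.+3.
    have -> : (m.+3 = m.-1.+4)%N by clear -m_gt1; lia.
    by apply: V2 => //; clear -m_gt1; lia.
  have /ZZ_u ZZ1 : (1 + m.-1 = m)%N by clear -m_gt1; lia.
  have : br y (br (Z 1) (Z m.-1) + u) \in V m.+4.+1.
    by rewrite flag_br //; move: ZZ1; rewrite expr1 scaleN1r opprK.
  rewrite linearD /= rpredDl // (lie_leibniz br_lie) rpredD //.
    have -> : (m.+4.+1 = 4 + m.-1.+2)%N by clear -m_gt1; lia.
    by apply: flag_graded => //; apply: flag_br23 Vy (VZ 1).
  exact: (flag_graded (a := 2) (VZ 1) Vym isT isT).
(* [L] is spanned by [x], [y] and [V 3], all of which send [V m.+3] into [V m.+4.+1]. *)
have /flag_proper/negP[] : (0 < m.+4 <= n)%N by [].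
rewrite [X in (X <= _)%VS](flag_gen flagV) //; apply/lie_prodvP => p v _ Vv.
have [s Vp] := line_x p; have [d Vv'] := flag_line Vu nVu Vv isT.
apply: mem_lie_mod Vxu (flag_br _ Vv' isT) _ => //.
have [t Vp'] := flag_line Vy nVy Vp isT.
apply: mem_lie_mod Vyu (flag_br _ Vv' isT) _ => //.
exact: (flag_graded (a := 2) Vp' Vv isT isT).
Qed.

(** Strong induction: the centralizer property settles [j = 2] and [j = 3], and [flag_br2_step] the
    rest. The case [j = n.-1] is left out, since there the bracket may fill the last line. *)
Lemma flag_br2 j x w : (1 < j)%N -> (j.+2 <= n)%N ->
  x \in V 2 -> w \in V j -> br x w \in V j.+2.
Proof.
elim/ltn_ind: j x w => j IHj x w j_gt1 lt_jn Vx Vw.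
case: j => [|[|[|[|j]]]] // in IHj j_gt1 lt_jn Vw *.
- by apply: mem_flag (flag_br22 _ Vx Vw) _.
- exact: flag_br23.
- apply: (@flag_br2_step j.+2) => // i y z /andP[i_gt1 lt_ij] Vy Vz.
  by apply: IHj => //; apply: leq_trans lt_jn; rewrite ltnS; apply: leqW.
Qed.

Lemma flag_graded_min a b u v : (3 < n)%N -> (1 < a)%N -> (1 < b)%N ->
  u \in V a -> v \in V b -> br u v \in V (minn (a + b) n).
Proof.
move=> n_gt3 a_gt1 b_gt1 Vu Vv.
have -> : n = n.-1.+1 by clear -n_gt3; lia.
apply: flag_graded_upto Vu Vv => // j x w lt_jn Vx Vw.
by apply: flag_br2 => //; clear -lt_jn n_gt3; lia.
Qed.

(** * Weights of a derivation on the flag *)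

Section Derivation.
Variable D : 'End(L).
Hypothesis derD : lie_derivation br D.
Hypothesis n_gt3 : (3 < n)%N.
Implicit Types c lam mu : F.

(** A derivation preserves the central series, hence also the centralizer of [C^1 / C^3]. *)
Lemma flag_stable i u : u \in V i -> (0 < i)%N -> D u \in V i.
Proof.
have stable_gt2 j w : w \in V j.+3 -> D w \in V j.+3.
  elim: j w => [|j IHj] w Vw.
    rewrite memv_preim; move: w Vw; apply/subvP.
    rewrite [X in (X <= _)%VS](flag_derived flagV).
    by apply/lie_prodvP => x y _ _; rewrite -memv_preim derD rpredD ?flag_br3.
  by apply: flag_ind Vw => // x y Vy; rewrite derD rpredD ?flag_br ?IHj.
case: i => [|[|[|i]]] // Vu _; [exact: mem_flag1 | | exact: stable_gt2].
apply/(flag_centralizer flagV) => v Vv.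
rewrite -[br _ _](addrK (br u (D v))) -derD.
by rewrite rpredB ?stable_gt2 ?flag_br23 ?stable_gt2.
Qed.

(** The eigenvalue of [D] on the line [V i / V i.+1], expressed without quotients. *)
Definition flag_weight i c := forall v, v \in V i -> D v - c *: v \in V i.+1.

Lemma flag_weight_exists i : (0 < i <= n)%N -> exists c, flag_weight i c.
Proof.
move=> le_in; have [e Ve nVe] := flag_rep le_in; case/andP: le_in => i_gt0 _.
have [c Vc] := flag_line Ve nVe (flag_stable Ve i_gt0) i_gt0.
exists c => v Vv; have [d Vd] := flag_line Ve nVe Vv i_gt0.
have -> : D v - c *: v =
    d *: (D e - c *: e) + (D (v - d *: e) - c *: (v - d *: e)).
  by rewrite linearB linearZ /=; vect_ring.
apply: rpredD; first exact: rpredZ.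
apply: rpredB; first exact: flag_stable.
exact: rpredZ.
Qed.

Lemma flag_weight_eigen i c d u : flag_weight i c -> u \in V i -> u \notin V i.+1 ->
  D u = d *: u -> c = d.
Proof.
move=> wt Vu nVu Du; have := wt u Vu.
rewrite Du -scalerBl rpredZeq (negPf nVu) orbF subr_eq0.
by move/eqP.
Qed.

(** This identity is why weights add under the bracket. *)
Lemma lie_derivation_sub c d u v :
  D (br u v) - (c + d) *: br u v = br (D u - c *: u) v + br u (D v - d *: v).
Proof.
rewrite derD linearBl linearZl_LR /= linearB linearZ /=; vect_ring.
Qed.

Lemma flag_weight_succ i lam c : flag_weight 1 lam -> flag_weight i c -> (1 < i)%N ->
    (forall x w, x \in V 2 -> w \in V i -> br x w \in V i.+2) ->
  flag_weight i.+1 (lam + c).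
Proof.
move=> wt1 wti i_gt1 V2 w Vw.
pose f : 'End(L) := D - (lam + c) *: \1%VF.
have fE v : D v - (lam + c) *: v = f v.
  by rewrite add_lfunE opp_lfunE scale_lfunE id_lfunE.
rewrite fE; apply: flag_ind Vw => // u v Vv.
rewrite -fE lie_derivation_sub rpredD //; first by rewrite V2 ?wt1 ?mem_flag1.
by rewrite flag_br ?wti.
Qed.

Lemma flag_weight_mid i lam mu : flag_weight 1 lam -> flag_weight 2 mu ->
  (i.+2 < n)%N -> flag_weight i.+2 (mu + i%:R * lam).
Proof.
move=> wt1 wt2; elim: i => [|i IHi] lt_in; first by rewrite mul0r addr0.
rewrite -natr1 mulrDl mul1r addrA addrC.
apply: flag_weight_succ => //; first exact: IHi (ltnW lt_in).
by move=> x w; apply: flag_br2.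
Qed.

(* The top weight is one step [lam] above the previous one, unless [V 2] acts
   nontrivially on [V n.-1], as in the algebras [Q_n]. *)
Lemma flag_weight_last m lam mu : n = m.+3 ->
    flag_weight 1 lam -> flag_weight 2 mu ->
  flag_weight n (lam + (mu + m%:R * lam)) \/ flag_weight n (mu + (mu + m%:R * lam)).
Proof.
move=> n_m wt1 wt2.
have wtm : flag_weight m.+2 (mu + m%:R * lam) by apply: flag_weight_mid; rewrite ?n_m.
have [V2 | nV2] := boolp.EM (forall x w, x \in V 2 -> w \in V m.+2 -> br x w \in V m.+4).
  by left; rewrite n_m; apply: flag_weight_succ.
right; rewrite n_m.
move/boolp.existsNP: nV2 => [x /boolp.existsNP[w /boolp.not_implyP[Vx]]].
move=> /boolp.not_implyP[Vw /negP nVxw] u Vu.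
have [d Vd] := flag_line (flag_br x Vw isT) nVxw Vu isT.
have V0 v : v \in V m.+4 -> v = 0 by apply: flag_eq0; rewrite n_m.
have /eqP := V0 _ Vd; rewrite subr_eq0 => /eqP ->.
rewrite linearZ /= scalerA mulrC -scalerA -scalerBr lie_derivation_sub.
rewrite rpredZ // rpredD //; last by rewrite flag_br ?wtm.
exact: (flag_graded (a := 2) (wt2 _ Vx) Vw isT isT).
Qed.

(* When [mu] is a positive multiple of [lam], so is every weight; the kernel
   forces one of them to vanish. *)
Lemma nilpotent_of_weights lam mu p v : flag_weight 1 lam -> flag_weight 2 mu ->
  mu = p.+1%:R * lam -> v != 0 -> D v = 0 -> nilpotent_endomorphism D.
Proof.
move=> wt1 wt2 mu_p v_neq0 Dv.
have wt i : (0 < i <= n)%N -> exists q, flag_weight i (q.+1%:R * lam).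
  case: i => [|[|i]] // lt_in; first by exists 0; rewrite mul1r.
  case/andP: lt_in => _; rewrite leq_eqVlt => /predU1P[n_i | lt_in]; last first.
    exists (p + i)%N; rewrite -addSn natrD mulrDl -mu_p; exact: flag_weight_mid.
  case: i => [|i] in n_i *; first by move: n_gt3; rewrite -n_i.
  rewrite n_i; have [] := flag_weight_last (esym n_i) wt1 wt2.
    exists (p + i.+1)%N; suff -> : (p + i.+1).+1%:R * lam = lam + (mu + i%:R * lam) by [].
    by rewrite mu_p; ring.
  exists (p.+1 + p + i)%N; suff -> : (p.+1 + p + i).+1%:R * lam = mu + (mu + i%:R * lam) by [].
  by rewrite mu_p; ring.
(* The degree [i] of the kernel vector [v]: the weight there is 0, which forces [lam = 0]. *)
have [i le_in [Vv nVv]] : exists2 i, (0 < i <= n)%N & v \in V i /\ v \notin V i.+1.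
  have exV : exists i, (v \notin V i.+1).
    by exists n; apply: contra v_neq0 => /flag_eq0 ->.
  case: (ex_minnP exV) => i nVv min_i.
  have i_gt0 : (0 < i)%N by rewrite lt0n; apply: contra nVv => /eqP ->; apply: mem_flag1.
  have Vv : v \in V i.
    case: i i_gt0 min_i {nVv} => // i _ min_i.
    by apply: contraT => /min_i; rewrite ltnn.
  exists i => //; rewrite i_gt0 leqNgt; apply: contra v_neq0 => lt_ni.
  by rewrite (flag_eq0 lt_ni Vv).
have lam0 : lam = 0.
  have [q wtq] := wt i le_in.
  have /eqP : q.+1%:R * lam = 0 by apply: flag_weight_eigen wtq Vv nVv _; rewrite Dv scale0r.
  by rewrite mulf_eq0 pnatr_eq0 => /eqP.
(* With all weights zero, [D] raises the degree by one at each application. *)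
exists n => x; apply: (@flag_eq0 n.+1) => //.
have: (n <= n)%N by []; elim: {1 3 4}n => [|i' IHi] lt_in /=; first exact: mem_flag1.
have [//|q wtq] := wt i'.+1.
have := wtq _ (IHi (ltnW lt_in)).
by rewrite lam0 mulr0 scale0r subr0.
Qed.

(* The bracket of [V a] and [V b] lies in [V (a + b)], whereas additivity of
   weights only allows it to meet degree [m] nontrivially if
   [mu = (m + 2 - a - b) lam], which is excluded for [m >= a + b]. *)
Lemma flag_br2_top lam mu : flag_weight 1 lam -> flag_weight 2 mu ->
    (forall p, mu != p.+1%:R * lam) ->
  forall u v, u \in V 2 -> v \in V 2 -> br u v \in V n.
Proof.
move=> wt1 wt2 mu_lam.
suff brV m : (m.+4 <= n)%N -> forall u v, u \in V 2 -> v \in V 2 -> br u v \in V m.+4.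
  have n4 : n = (n - 4).+4 by clear -n_gt3; lia.
  by rewrite n4; apply: brV; rewrite -n4.
elim: m => [|m IHm] lt_mn u v Vu Vv; first by apply: mem_flag (flag_br22 _ Vu Vv) _.
(* Descending induction on [a + b], with [s] bounding its distance to [m.+4.+1]: subtracting weights
   moves [x] or [y] one step down the flag. *)
suff brV s a b : (1 < a)%N -> (1 < b)%N -> (m.+4 < a + b + s)%N ->
    forall x y, x \in V a -> y \in V b -> br x y \in V m.+4.+1.
  by apply: (brV m.+1 2 2).
elim: s a b => [|s IHs] a b a_gt1 b_gt1 lt_m_abs x y Vx Vy.
  apply: mem_flag (flag_graded_min n_gt3 a_gt1 b_gt1 Vx Vy) _.
  by clear -lt_m_abs lt_mn; lia.
have [lt_m_ab | le_ab_m] := ltnP m.+4 (a + b).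
  apply: mem_flag (flag_graded_min n_gt3 a_gt1 b_gt1 Vx Vy) _.
  by clear -lt_m_ab lt_mn; lia.
have wta : flag_weight a (mu + (a - 2)%:R * lam).
  rewrite -[in flag_weight a](subnK a_gt1) addn2.
  by apply: flag_weight_mid => //; clear -a_gt1 b_gt1 le_ab_m lt_mn; lia.
have wtb : flag_weight b (mu + (b - 2)%:R * lam).
  rewrite -[in flag_weight b](subnK b_gt1) addn2.
  by apply: flag_weight_mid => //; clear -a_gt1 b_gt1 le_ab_m lt_mn; lia.
have wtm := flag_weight_mid wt1 wt2 lt_mn.
set ca := _ + _ in wta; set cb := _ + _ in wtb; set cm := _ + _ in wtm.
have Vxy : br x y \in V m.+4.
  by apply: IHm (ltnW lt_mn) _ _ (mem_flag Vx _) (mem_flag Vy _).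
have : (cm - (ca + cb)) *: br x y \in V m.+4.+1.
  have -> : (cm - (ca + cb)) *: br x y = br (D x - ca *: x) y
      + br x (D y - cb *: y) - (D (br x y) - cm *: br x y).
    by rewrite -lie_derivation_sub; vect_ring.
  rewrite rpredB ?wtm // rpredD //.
    by apply: (IHs a.+1 b _ _ _ _ _ (wta _ Vx) Vy) => //; clear -lt_m_abs a_gt1; lia.
  by apply: (IHs a b.+1 _ _ _ _ _ Vx (wtb _ Vy)) => //; clear -lt_m_abs b_gt1; lia.
rewrite rpredZeq => /predU1P[eq_c | //].
have [p m_p] : exists p, (m.+2 = (a - 2) + (b - 2) + p.+1)%N.
  by exists (m.+4.+1 - (a + b))%N; clear -a_gt1 b_gt1 le_ab_m; lia.
case/negP: (mu_lam p); rewrite eq_sym -subr_eq0.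
suff -> : p.+1%:R * lam - mu = cm - (ca + cb) by rewrite eq_c.
by rewrite /cm m_p !natrD /ca /cb; ring.
Qed.

Lemma affine_of_flag : ~ nilpotent_endomorphism D ->
  exists nabla : {bilinear L -> L -> L}, is_affine_structure br nabla.
Proof.
move=> nnilD; have [kerD0 | kerD] := eqVneq (lker D) 0%VS.
  by apply: affine_of_injective_derivation derD _; rewrite ?kerD0.
have v_neq0 : vpick (lker D) != 0 by rewrite vpick0.
have Dv : D (vpick (lker D)) = 0 by apply/eqP; rewrite -memv_ker memv_pick.
have [lam wt1] : exists c, flag_weight 1 c by apply: flag_weight_exists; clear -n_gt3; lia.
have [mu wt2] : exists c, flag_weight 2 c by apply: flag_weight_exists; clear -n_gt3; lia.
have mu_lam p : mu != p.+1%:R * lam.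
  by apply/eqP => mu_p; apply: nnilD; apply: nilpotent_of_weights wt1 wt2 mu_p v_neq0 Dv.
have V22 := flag_br2_top wt1 wt2 mu_lam.
have [x0 _ nVx0] : exists2 e, e \in V 1 & e \notin V 2.
  by apply: flag_rep; clear -n_gt3; lia.
apply: (affine_of_two_step_hyperplane br_lie (x0 := x0) (T := V 2)).
- move=> x; have [c Vx] := flag_line (mem_flag1 x0) nVx0 (mem_flag1 x) isT.
  by rewrite -(subrK (c *: x0) x) addrC memv_add // memvZ ?memv_line.
- by move=> x y; apply: mem_flag (flag_br3 x y) _.
- move=> x y z Vx Vy Vz; apply: (@flag_eq0 n.+1) => //; apply: flag_br; first exact: V22.
  by clear -n_gt3; lia.
Qed.

End Derivation.
End Flag.

(** * Construction of the flag, and dimension at most 3 *)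

Section Filiform.
Variables (F : numFieldType) (L : vectType F) (br : {bilinear L -> L -> L}).
Hypothesis br_lie : is_lie_bracket br.
Hypothesis br_filiform : filiform br.
Let n := \dim {: L}.

Lemma central_seriesS i : (central_series br i.+1 <= central_series br i)%VS.
Proof.
elim: i => [|i IHi]; first exact: subvf.
by apply/lie_prodvP => u v Lu /(subvP IHi) Cv; apply: memv_lie_prodv.
Qed.

Lemma dim_central_series i : (0 < i)%N -> (1 < n)%N ->
  \dim (central_series br i) = (n - i - 1)%N.
Proof.
have [_ dimC] := br_filiform; move=> i_gt0 n_gt1.
have [le_in | lt_ni] := leqP i n.-1; first by apply: dimC; rewrite -/n; lia.
have dim0 j : \dim (central_series br (n.-1 + j)) = 0%N.
  elim: j => [|j IHj]; first by rewrite addn0 dimC -/n; lia.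
  apply/eqP; rewrite -leqn0 -IHj addnS; apply/dimvS/central_seriesS.
by have := dim0 (i - n.-1)%N; rewrite subnKC ?(ltnW lt_ni) // => ->; lia.
Qed.

Lemma exists_filiform_flag : (3 < n)%N -> exists V, filiform_flag br V.
Proof.
move=> n_gt3.
pose C := central_series br.
have dimC i : (0 < i)%N -> \dim (C i) = (n - i - 1)%N.
  by move=> i_gt0; apply: dim_central_series => //; apply: leq_trans n_gt3.
have properC i : (0 < i < 3)%N -> ~~ (C i <= C i.+1)%VS.
  by move=> lt_i; apply/negP => /dimvS; rewrite !dimC //; clear -lt_i n_gt3; lia.
have lineC i e u : (0 < i)%N -> e \in C i -> e \notin C i.+1 -> u \in C i ->
    exists c, u - c *: e \in C i.+1.
  move=> i_gt0; apply: line_modP; first exact: central_seriesS.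
  by rewrite !dimC //; clear; lia.
have [//|e Ce nCe] := subvPn (properC 1%N _).
(* Since [e] spans [C 1] modulo [C 2], testing on [e] alone defines the centralizer, with
   codimension at most 1 because [C 2 / C 3] is a line. *)
pose T := (linfun (applyr br e) @^-1: C 3)%VS.
have TE u : (u \in T) = (br u e \in C 3) by rewrite -memv_preim lfunE.
have brC i u v : v \in C i -> br u v \in C i.+1.
  by move=> Cv; apply: memv_lie_prodv; rewrite ?memvf.
have centT u : u \in T <-> (forall v, v \in C 1 -> br u v \in C 3).
  rewrite TE; split=> [Cue v Cv | ]; last exact.
  have [//|d Cd] := lineC 1%N e v _ Ce nCe Cv.
  by apply: (mem_lie_modr Cue (brC _ _ _ Cd)).
have /subvPn[x0 _ nTx0] : ~~ (fullv <= T)%VS.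
  have := properC 2%N isT; apply: contra => /subvP sT.
  apply/lie_prodvP => u v Lu Cv.
  by have /centT := sT u Lu; apply.
have lineT x : exists c, x - c *: x0 \in T.
  rewrite TE in nTx0; have [//|c Cc] := lineC 2%N _ _ _ (brC _ x0 _ Ce) nTx0 (brC _ x _ Ce).
  by exists c; rewrite TE linearBl linearZl_LR.
have fullT : fullv = (<[x0]> + T)%VS.
  apply/esym/eqP; rewrite eqEsubv subvf /=; apply/subvP => x _.
  by have [c Tx] := lineT x; rewrite -(subrK (c *: x0) x) addrC memv_add // memvZ ?memv_line.
have dimT : \dim T = (n - 1)%N.
  apply/eqP; rewrite eqn_leq.
  have : (\dim T < n)%N.
    rewrite ltnNge; apply: contra nTx0 => dimT.
    have /eqP T_full : T == fullv by rewrite eqEdim subvf.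
    by rewrite T_full memvf.
  have : (n <= 1 + \dim T)%N.
    rewrite /n fullT; apply: leq_trans (dimv_add_leqif _ _) _.
    by rewrite leq_add2r dim_vline leq_b1.
  by clear; lia.
(* Truncated subtraction gives [C 0 = L] at index 1. *)
exists (fun i => if i == 2 then T else C (i - 2)%N); split=> //=.
- case=> [|[|[|i]]] // _; rewrite -/n; [|by rewrite dimT; clear; lia|].
    by rewrite subn1 addn1.
  by rewrite !subSS subn0 dimC //; clear; lia.
- case=> [|[|[|i]]] // _.
  (* [[L, L] = [L, T]], since [x0] and [T] span [L] and [br x0 x0 = 0]. *)
  rewrite /= /C; apply/eqP; rewrite eqEsubv; apply/andP; split; apply/lie_prodvP => u v _.
    have [[c Tu] [d Tv]] := (lineT u, lineT v) => _.
    set K := lie_prodv _ _ _.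
    apply: (mem_lie_mod (e := x0) (f := x0) (c := c) (d := d)).
    + by rewrite (lie_alternating br_lie) mem0v.
    + by apply: memv_lie_prodv; rewrite ?memvf.
    + by rewrite (lie_antisym br_lie) rpredN memv_lie_prodv ?memvf.
  by move=> _; apply: memv_lie_prodv; rewrite ?memvf.
Qed.

(** With [x0 = 0] and [T = L], the hyperplane construction is [1/2 [x, y]]. Here [C^2 = 0] by
    dimension, and in dimension at most 1 the bracket is zero. *)
Lemma affine_of_dim_le3 : (n <= 3)%N ->
  exists nabla : {bilinear L -> L -> L}, is_affine_structure br nabla.
Proof.
move=> n_le3.
apply: (affine_of_two_step_hyperplane br_lie (x0 := 0) (T := fullv)).
- by move=> x; apply: subvP (addvSr _ _) _ (memvf x).
- by move=> x y; apply: memvf.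
move=> x y z _ _ _; have [n_gt1 | n_le1] := ltnP 1 n.
  have : br x (br y z) \in central_series br 2.
    by apply: memv_lie_prodv; rewrite ?memvf // memv_lie_prodv ?memvf.
  suff -> : central_series br 2 = 0%VS by rewrite memv0 => /eqP.
  by apply/eqP; rewrite -dimv_eq0 dim_central_series //; lia.
suff br0 u v : br u v = 0 by rewrite !br0.
have [-> | u_neq0] := eqVneq u 0; first by rewrite linear0l.
have [|||||c] := @line_modP _ L fullv 0%VS u v; rewrite ?memvf ?sub0v ?memv0 //.
  by rewrite dimv0.
rewrite subr_eq0 => /eqP ->.
by rewrite linearZ /= (lie_alternating br_lie) scaler0.
Qed.
End Filiform.

Theorem theorem3p1 (R : realType) (L : vectType R)
    (br : {bilinear L -> L -> L}) (br_lie : is_lie_bracket br)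
    (br_filiform : filiform br)
    (br_not_char_nilpotent : ~ characteristically_nilpotent br) :
  exists nabla : {bilinear L -> L -> L}, is_affine_structure br nabla.
Proof.
have [n_le3 | n_gt3] := leqP (\dim {: L}) 3; first exact: affine_of_dim_le3.
have [V flagV] := exists_filiform_flag br_lie br_filiform n_gt3.
move/boolp.existsNP: br_not_char_nilpotent => [D /boolp.not_implyP[derD nnilD]].
exact: (affine_of_flag br_lie flagV derD n_gt3 nnilD).
Qed.
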